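(* Let $k$ be an algebraically closed field of characteristic zero, let $\beta\in k^*$ have order $20$, and put $B=\mathrm{diag}[1,\beta,\beta^{-2},\beta^7]$, $C=[e_4,e_1,e_2,e_3]$ (the matrix with the indicated columns of the unit matrix). Let $$G_{80}=\{(B)^i(C)^j: 0\le i\le 19,\ 0\le j\le 3\},$$ which is a subgroup of $PGL_4(k)$ of order $80$. Then $$\mathrm{Paut}(x^3y+y^3z+z^3t+t^3x)=G_{80}.$$
   Context: For $A\in GL_4(k)$, $(A)$ is its class in $PGL_4(k)$. For a form $f\in k[x,y,z,t]$, $f_{A^{-1}}$ denotes the form $v\mapsto f(Av)$, and $\mathrm{Paut}(f)=\{(A)\in PGL_4(k): f_{A^{-1}}=cf\text{ for some }c\in k^*\}$. *)

(* Defs.v *)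
From HB Require Import structures.
From mathcomp Require Import all_boot all_algebra.
From mathcomp Require Import finmap.
From mathcomp Require Import mpoly.

Set Implicit Arguments.
Unset Strict Implicit.
Unset Printing Implicit Defensive.

Import GRing.Theory.
Local Open Scope ring_scope.

(* MathComp's 'GL_n[R] requires R to be finite; [GL k n] is the general linear *)
(* group of an arbitrary field.                                                *)
Section GL.
Variables (k : fieldType) (n : nat).

Record GL := MkGL { glval : 'M[k]_n; glvalP : glval \in unitmx }.

HB.instance Definition _ := [isSub for glval].
HB.instance Definition _ := [Choice of GL by <:].

Lemma gl_one_subproof : (1%:M : 'M[k]_n) \in unitmx.
Proof. exact: unitmx1. Qed.

Lemma gl_mul_subproof (A B : GL) : glval A *m glval B \in unitmx.
Proof. by rewrite unitmx_mul !glvalP. Qed.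

Lemma gl_inv_subproof (A : GL) : invmx (glval A) \in unitmx.
Proof. by rewrite unitmx_inv glvalP. Qed.

Definition gl_one : GL := MkGL gl_one_subproof.
Definition gl_mul (A B : GL) : GL := MkGL (gl_mul_subproof A B).
Definition gl_inv (A : GL) : GL := MkGL (gl_inv_subproof A).

Lemma gl_mulA : associative gl_mul.
Proof. by move=> A B C; apply: val_inj; rewrite /= mulmxA. Qed.

Lemma gl_mul1g : left_id gl_one gl_mul.
Proof. by move=> A; apply: val_inj; rewrite /= mul1mx. Qed.

Lemma gl_mulg1 : right_id gl_one gl_mul.
Proof. by move=> A; apply: val_inj; rewrite /= mulmx1. Qed.

Lemma gl_mulVg : left_inverse gl_one gl_inv gl_mul.
Proof. by move=> A; apply: val_inj; rewrite /= mulVmx ?glvalP. Qed.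

Lemma gl_mulgV : right_inverse gl_one gl_inv gl_mul.
Proof. by move=> A; apply: val_inj; rewrite /= mulmxV ?glvalP. Qed.

HB.instance Definition _ :=
  isGroup.Build GL gl_mulA gl_mul1g gl_mulg1 gl_mulVg gl_mulgV.

End GL.

Section PGL.
Variables (k : fieldType) (n : nat).

(* Congruence modulo the (normal) subgroup of scalar matrices. *)
Definition pgl_rel : rel (GL k n) :=
  fun A B => is_scalar_mx (glval (A^-1 * B)%g).

Lemma pgl_relP (A B : GL k n) :
  reflect (exists2 c : k, c%:M \in (unitmx : pred 'M[k]_n) &
             glval B = c *: glval A) (pgl_rel A B).
Proof.
apply: (iffP idP) => [|[c uc defB]].
  rewrite /pgl_rel => /is_scalar_mxP[c defc]; exists c.
    by rewrite -defc; apply: glvalP.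
  by rewrite -mul_mx_scalar -defc /= mulKVmx ?glvalP.
apply/is_scalar_mxP; exists c.
by rewrite /= defB -scalemxAr mulVmx ?glvalP // scalemx1.
Qed.

Lemma pgl_rel_refl : reflexive pgl_rel.
Proof. by move=> A; apply/pgl_relP; exists 1; rewrite ?unitmx1 ?scale1r. Qed.

Lemma pgl_rel_sym : ssrbool.symmetric pgl_rel.
Proof.
suff imp A B : pgl_rel A B -> pgl_rel B A by move=> A B; apply/idP/idP; apply: imp.
rewrite /pgl_rel => /is_scalar_mxP[c defc]; apply/is_scalar_mxP; exists c^-1.
by rewrite -invmx_scalar -defc; have -> : (B^-1 * A = (A^-1 * B)^-1)%g
  by rewrite invgM invgK.
Qed.

Lemma pgl_rel_trans : transitive pgl_rel.
Proof.
move=> B A C /pgl_relP[c uc defB] /pgl_relP[d ud defC].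
apply/pgl_relP; exists (d * c); last by rewrite defC defB scalerA.
by rewrite scalar_mxM unitmx_mul ud uc.
Qed.

Canonical pgl_equiv :=
  EquivRel pgl_rel pgl_rel_refl pgl_rel_sym pgl_rel_trans.

Definition PGL := {eq_quot pgl_equiv}%qT.

HB.instance Definition _ : EqQuotient _ pgl_equiv PGL := EqQuotient.on PGL.
HB.instance Definition _ := Choice.on PGL.

Definition pclass (A : GL k n) : PGL := (\pi_PGL A)%qT.

Lemma eq_pclass (A B : GL k n) : (pclass A == pclass B) = pgl_rel A B.
Proof. exact: eqmodE. Qed.

Lemma pclass_repr (g : PGL) : pclass (repr g) = g.
Proof. exact: reprK. Qed.

Definition pgl_one : PGL := pclass 1%g.
Definition pgl_mul (g h : PGL) : PGL := pclass (repr g * repr h)%g.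
Definition pgl_inv (g : PGL) : PGL := pclass (repr g)^-1%g.

Lemma pclassM (A B : GL k n) : pclass (A * B)%g = pgl_mul (pclass A) (pclass B).
Proof.
have relr X : pgl_rel X (repr (pclass X)) by rewrite -eq_pclass pclass_repr.
have /pgl_relP[c uc defA] := relr A; have /pgl_relP[d ud defB] := relr B.
apply/eqP; rewrite /pgl_mul eq_pclass; apply/pgl_relP.
exists (d * c); first by rewrite scalar_mxM unitmx_mul ud uc.
by rewrite /= defA defB -scalemxAl -scalemxAr scalerA mulrC.
Qed.

Lemma pclassV (A : GL k n) : pclass A^-1%g = pgl_inv (pclass A).
Proof.
have: pgl_rel A (repr (pclass A)) by rewrite -eq_pclass pclass_repr.
case/pgl_relP=> c uc defA.
apply/eqP; rewrite /pgl_inv eq_pclass pgl_rel_sym; apply/pgl_relP.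
exists c => //; set X := repr _ in defA *.
rewrite /= -[LHS]mulmx1 -(mulmxV (glvalP X)) {1}defA.
by rewrite -scalemxAl -scalemxAr mulKmx ?glvalP.
Qed.

Lemma pgl_mulA : associative pgl_mul.
Proof.
move=> a b c; rewrite -(pclass_repr a) -(pclass_repr b) -(pclass_repr c).
by rewrite -!pclassM mulgA.
Qed.

Lemma pgl_mul1g : left_id pgl_one pgl_mul.
Proof. by move=> a; rewrite -(pclass_repr a) -pclassM mul1g. Qed.

Lemma pgl_mulg1 : right_id pgl_one pgl_mul.
Proof. by move=> a; rewrite -(pclass_repr a) -pclassM mulg1. Qed.

Lemma pgl_mulVg : left_inverse pgl_one pgl_inv pgl_mul.
Proof. by move=> a; rewrite -(pclass_repr a) -pclassV -pclassM mulVg. Qed.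

Lemma pgl_mulgV : right_inverse pgl_one pgl_inv pgl_mul.
Proof. by move=> a; rewrite -(pclass_repr a) -pclassV -pclassM mulgV. Qed.

HB.instance Definition _ :=
  isGroup.Build PGL pgl_mulA pgl_mul1g pgl_mulg1 pgl_mulVg pgl_mulgV.

End PGL.

Section Paut.
Variables (k : fieldType) (n : nat).

(* The form v |-> f (A v), v a column vector: 'X_i is replaced by the i-th *)
(* coordinate of A v.                                                      *)
Definition form_subst (f : {mpoly k[n]}) (A : 'M[k]_n) : {mpoly k[n]} :=
  f \mPo [tuple \sum_(j < n) A i j *: 'X_j | i < n].

Definition Paut (f : {mpoly k[n]}) (g : PGL k n) : Prop :=
  exists A : GL k n, g = pclass A /\
    exists2 c : k, c != 0 & form_subst f (glval A) = c *: f.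

End Paut.

Section G80.
Variable k : fieldType.

Definition Bmx (beta : k) : 'M[k]_4 :=
  diag_mx (\row_(i < 4) [tuple 1; beta; beta ^- 2; beta ^+ 7]`_i).

(* Column j of C is the unit vector with index (e_4, e_1, e_2, e_3)_j; indices *)
(* are shifted by one since 'I_4 starts at 0.                                  *)
Definition Cmx : 'M[k]_4 :=
  \matrix_(i < 4, j < 4) (val i == nth 0 [:: 3; 0; 1; 2] j)%N%:R.

Lemma Bmx_unit (beta : k) : beta != 0 -> Bmx beta \in unitmx.
Proof.
move=> b0; rewrite unitmxE det_diag unitfE; apply/prodf_neq0 => i _.
by rewrite mxE; case: i => -[|[|[|[|]]]] //= _;
  rewrite ?oner_eq0 ?invr_eq0 ?expf_neq0.
Qed.

Lemma Cmx_unit : Cmx \in unitmx.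
Proof.
suff CCt : Cmx *m Cmx^T = 1%:M by case: (mulmx1_unit CCt).
apply/matrixP => i j; rewrite !mxE !big_ord_recr big_ord0 /= !mxE /=.
by case: i => -[|[|[|[|]]]] //= ?; case: j => -[|[|[|[|]]]] //= ?;
  rewrite ?(mulr0, mul0r, mulr1, addr0, add0r).
Qed.

Definition Bgl (beta : k) (beta0 : beta != 0) : GL k 4 := MkGL (Bmx_unit beta0).
Definition Cgl : GL k 4 := MkGL Cmx_unit.

Definition G80 (beta : k) (beta0 : beta != 0) : {fset PGL k 4} :=
  [fset (pclass (Bgl beta0) ^+ i * pclass Cgl ^+ j)%g | i in iota 0 20, j in iota 0 4]%fset.

Definition klein_form : {mpoly k[4]} :=
  let x := 'X_(inord 0) in let y := 'X_(inord 1) in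
  let z := 'X_(inord 2) in let t := 'X_(inord 3) in
  x ^+ 3 * y + y ^+ 3 * z + z ^+ 3 * t + t ^+ 3 * x.

End G80.

(* Main.v *)
(** The polar form P(p, q, w, s) of a quartic form f is equivariant under
    every A that multiplies f by a scalar. For f = x^3y + y^3z + z^3t + t^3x, the
    pairs of nonzero vectors (p, q) with P(p, q, -, -) = 0 are, up to
    scalars, exactly the pairs (e_i, e_(i+2)). Hence A maps every
    coordinate axis to a coordinate axis, and comparing the values at
    (e_i, e_i, e_i, e_j) shows that it permutes the axes cyclically, with
    entries d_r satisfying d_r^3 d_(r+1) = c. Up to a scalar these entries
    are 1, u, u^-2, u^7 with u = c / d_0^4 and u^20 = 1, so u is a power of
    beta. *)

Require Import Defs.
From mathcomp Require Import all_boot all_algebra.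
From mathcomp Require Import finmap.
From mathcomp Require Import mpoly.
From mathcomp Require Import ring.

Import GRing.Theory.
Local Open Scope ring_scope.

Lemma I4P (P : 'I_4 -> Prop) : P 0 -> P 1 -> P 2 -> P 3 -> forall i, P i.
Proof.
move=> P0 P1 P2 P3 [[|[|[|[|//]]]] lti].
- by rewrite (_ : Ordinal lti = 0) //; apply: val_inj.
- by rewrite (_ : Ordinal lti = 1) //; apply: val_inj.
- by rewrite (_ : Ordinal lti = 2) //; apply: val_inj.
- by rewrite (_ : Ordinal lti = 3) //; apply: val_inj.
Qed.

Lemma sum_I4 (V : nmodType) (F : 'I_4 -> V) :
  \sum_i F i = F 0 + F 1 + F 2 + F 3.
Proof.
rewrite !big_ord_recr big_ord0 /= add0r.
by congr (F _ + F _ + F _ + F _); apply: val_inj.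
Qed.

(** * The quartic as a function on vectors, and its polar form *)

Section Quartic.
Variable k : fieldType.
Implicit Types (p q w s v : 'cV[k]_4) (A : 'M[k]_4) (c : k).

Let e (i : 'I_4) : 'cV[k]_4 := delta_mx i 0.

(* Indices in ['I_4] are added modulo 4. *)
Definition quartic v : k := \sum_i v i 0 ^+ 3 * v (i + 1) 0.

Lemma klein_formE :
  klein_form k = \sum_(i : 'I_4) 'X_i ^+ 3 * 'X_(i + 1).
Proof.
rewrite sum_I4 /klein_form /=.
have -> : inord 0 = 0 :> 'I_4 by apply: val_inj; rewrite /= inordK.
have -> : inord 1 = 1 :> 'I_4 by apply: val_inj; rewrite /= inordK.
have -> : inord 2 = 2 :> 'I_4 by apply: val_inj; rewrite /= inordK.
have -> : inord 3 = 3 :> 'I_4 by apply: val_inj; rewrite /= inordK.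
have -> : 0 + 1 = 1 :> 'I_4 by apply: val_inj.
have -> : 1 + 1 = 2 :> 'I_4 by apply: val_inj.
have -> : 2 + 1 = 3 :> 'I_4 by apply: val_inj.
by have -> : 3 + 1 = 0 :> 'I_4 by apply: val_inj.
Qed.

Lemma klein_form_eval v : (klein_form k).@[fun i => v i 0] = quartic v.
Proof.
rewrite klein_formE rmorph_sum; apply: eq_bigr => i _.
by rewrite rmorphM rmorphXn /= !mevalXU.
Qed.

Lemma form_subst_eval A v :
  (form_subst (klein_form k) A).@[fun i => v i 0] = quartic (A *m v).
Proof.
rewrite comp_mpoly_meval -klein_form_eval; apply: meval_eq => i.
rewrite tnth_mktuple rmorph_sum mxE; apply: eq_bigr => j _.
by rewrite /= mevalZ mevalXU.
Qed.

(* The complete polarization of [quartic], divided by 6. *)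
Definition qpol p q w s : k :=
  \sum_i (p i 0 * q i 0 * w i 0 * s (i + 1) 0 +
          p i 0 * q i 0 * w (i + 1) 0 * s i 0 +
          p i 0 * q (i + 1) 0 * w i 0 * s i 0 +
          p (i + 1) 0 * q i 0 * w i 0 * s i 0).

(** Inclusion-exclusion isolates the part linear in each of the four arguments. A monomial v_i^3
    v_(i+1) yields 24 terms, six for each choice of the argument read at i + 1, whence the factor
    6. *)
Lemma qpolE p q w s :
  6 * qpol p q w s =
    quartic (p + q + w + s) -
    (quartic (p + q + w) + quartic (p + q + s) +
     quartic (p + w + s) + quartic (q + w + s)) +
    (quartic (p + q) + quartic (p + w) + quartic (p + s) +
     quartic (q + w) + quartic (q + s) + quartic (w + s)) -
    (quartic p + quartic q + quartic w + quartic s).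
Proof.
rewrite /qpol /quartic mulr_sumr -!big_split -!sumrB -!big_split -!sumrB /=.
by apply: eq_bigr => i _; rewrite !mxE; ring.
Qed.

(** Phrased with values rather than polynomials, so that products and inverses are immediate; the
    polynomial identity is recovered from explicit monomial matrices. *)
Definition semi_invariant A : Prop :=
  exists2 c, c != 0 & forall v, quartic (A *m v) = c * quartic v.

Lemma qpol_delta i j : qpol (e i) (e i) (e i) (e j) = (j == i + 1)%:R.
Proof.
elim/I4P: i; elim/I4P: j; rewrite /qpol sum_I4 /e !mxE /=;
  by rewrite !(mulr0, mul0r, mulr1, addr0, add0r).
Qed.

Lemma qpol_opposite i w s : qpol (e i) (e (i + 2)) w s = 0.
Proof.
elim/I4P: i; rewrite /qpol sum_I4 /e !mxE /=;
  by rewrite !(mulr0, mul0r, mulr1, addr0, add0r).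
Qed.

(** These are the coefficients of w_i s_(i+1) and w_i s_i in the bilinear form [qpol p q], read off
    at unit vectors. *)
Lemma qpol_eq0 p q : (forall w s, qpol p q w s = 0) ->
  forall i, p i 0 * q i 0 = 0 /\ p i 0 * q (i + 1) 0 + p (i + 1) 0 * q i 0 = 0.
Proof.
move=> pq0 i; split.
  rewrite -[RHS](pq0 (e i) (e (i + 1))) /qpol.
  elim/I4P: i; rewrite sum_I4 /e !mxE /=;
  by rewrite !(mulr0, mul0r, mulr1, addr0, add0r).
rewrite -[RHS](pq0 (e i) (e i)) /qpol.
elim/I4P: i; rewrite sum_I4 /e !mxE /=;
  by rewrite !(mulr0, mul0r, mulr1, addr0, add0r).
Qed.

(** As p_i is nonzero, q vanishes at i, i + 1 and i + 3, so q_(i+2) is nonzero; this in turn kills p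
    at i + 2, i + 1 and i + 3. *)
Lemma qpol_eq0_support p q i : (forall w s, qpol p q w s = 0) -> q != 0 ->
  p i 0 != 0 -> p = p i 0 *: e i.
Proof.
move=> /qpol_eq0 pq0 q0 pi0.
have i4 : i + 3 + 1 = i by elim/I4P: (i); apply: val_inj.
have i3 : i + 2 + 1 = i + 3 by elim/I4P: (i); apply: val_inj.
have i2 : i + 1 + 1 = i + 2 by elim/I4P: (i); apply: val_inj.
have shift (P : 'I_4 -> Prop) :
    P i -> P (i + 1) -> P (i + 2) -> P (i + 3) -> forall j, P j.
  move=> P0 P1 P2 P3 j; rewrite -(subrK i j) addrC.
  by elim/I4P: (j - i); rewrite ?addr0.
have qi : q i 0 = 0.
  by have [/eqP] := pq0 i; rewrite mulf_eq0 (negPf pi0) => /eqP.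
have qi1 : q (i + 1) 0 = 0.
  have [_ /eqP] := pq0 i; rewrite qi mulr0 addr0.
  by rewrite mulf_eq0 (negPf pi0) => /eqP.
have qi3 : q (i + 3) 0 = 0.
  have [_ /eqP] := pq0 (i + 3); rewrite i4 qi mulr0 add0r.
  by rewrite mulf_eq0 (negPf pi0) => /eqP.
have qi2 : q (i + 2) 0 != 0.
  apply: contraNneq q0 => qi2; apply/eqP/matrixP => j l.
  by rewrite ord1 mxE; move: j; exact: shift.
have pi2 : p (i + 2) 0 = 0.
  by have [/eqP] := pq0 (i + 2); rewrite mulf_eq0 (negPf qi2) orbF => /eqP.
have pi1 : p (i + 1) 0 = 0.
  have [_ /eqP] := pq0 (i + 1); rewrite i2 pi2 mul0r addr0.
  by rewrite mulf_eq0 (negPf qi2) orbF => /eqP.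
have pi3 : p (i + 3) 0 = 0.
  have [_ /eqP] := pq0 (i + 2); rewrite i3 pi2 mul0r add0r.
  by rewrite mulf_eq0 (negPf qi2) orbF => /eqP.
have neq m : m != 0 -> (i + m == i) = false.
  by move=> m0; rewrite -subr_eq0 addrAC subrr add0r; exact: negPf.
apply/matrixP => j l; rewrite ord1 !mxE andbT.
elim/shift: j; first by rewrite eqxx mulr1.
- by rewrite pi1 neq ?mulr0.
- by rewrite pi2 neq ?mulr0.
- by rewrite pi3 neq ?mulr0.
Qed.

(** * Monomial matrices with cyclic pattern, and reduction of semi-invariant matrices to them *)

Definition monmx (d : 'I_4 -> k) (m : 'I_4) : 'M[k]_4 :=
  \matrix_(r, s) (d r *+ (s == r + m)).

Lemma monmx_mul d m d' m' :
  monmx d m *m monmx d' m' = monmx (fun r => d r * d' (r + m)) (m + m').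
Proof.
apply/matrixP => r s; rewrite !mxE (bigD1 (r + m)) //= !mxE eqxx big1.
  by rewrite addr0 addrA mulrnAr.
by move=> t /negPf tr; rewrite !mxE tr mul0r.
Qed.

(** The substitution sends X_i to d_i X_(i+m), hence the i-th summand to c times the (i+m)-th. *)
Lemma form_subst_monmx c d m : (forall r, d r ^+ 3 * d (r + 1) = c) ->
  form_subst (klein_form k) (monmx d m) = c *: klein_form k.
Proof.
move=> dc.
have substX (i : 'I_4) :
    'X_i \mPo [tuple \sum_(j < 4) monmx d m i j *: 'X_j | i < 4] =
    d i *: 'X_(i + m) :> {mpoly k[4]}.
  rewrite comp_mpolyXU -tnth_nth tnth_mktuple (bigD1 (i + m)) //= mxE eqxx.
  rewrite big1 ?addr0 // => j /negPf ji.
  by rewrite mxE ji scale0r.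
rewrite /form_subst klein_formE rmorph_sum scaler_sumr.
rewrite [RHS](reindex_inj (addIr m)); apply: eq_bigr => i _.
rewrite rmorphM rmorphXn /= !substX exprZn -scalerAl -scalerAr scalerA dc.
by rewrite addrAC.
Qed.

Hypothesis six_neq0 : 6 != 0 :> k.

Lemma semi_invariant_qpol A c :
  (forall v, quartic (A *m v) = c * quartic v) ->
  forall p q w s,
    qpol (A *m p) (A *m q) (A *m w) (A *m s) = c * qpol p q w s.
Proof.
move=> Ac p q w s; apply: (mulfI six_neq0).
by rewrite mulrCA !qpolE -!mulmxDr !Ac; ring.
Qed.

(** By equivariance the degenerate pair (e_j, e_(j+2)) goes to a degenerate pair of nonzero vectors,
    to which [qpol_eq0_support] applies. The sigma type lets scalars and indices be collected into
    functions of [j]. *)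
Lemma semi_invariant_column A c : A \in unitmx ->
  (forall v, quartic (A *m v) = c * quartic v) ->
  forall j, {a : k & {i : 'I_4 | a != 0 & A *m e j = a *: e i}}.
Proof.
move=> uA /semi_invariant_qpol Ac j.
have Ae0 i : A *m e i != 0.
  apply/eqP => /(congr1 (mulmx (invmx A))); rewrite mulKmx // mulmx0.
  by move=> /matrixP/(_ i 0)/eqP; rewrite !mxE !eqxx oner_eq0.
have [i Aji] : {i | (A *m e j) i 0 != 0}.
  case: (pickP (fun i => (A *m e j) i 0 != 0)) => [i|Aj0]; first by exists i.
  case/eqP: (Ae0 j); apply/matrixP => i l.
  by rewrite ord1 [RHS]mxE; apply/eqP; have /negbFE := Aj0 i.
exists ((A *m e j) i 0), i => //.
apply: (@qpol_eq0_support _ (A *m e (j + 2))) => // w s.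
rewrite -(mulKVmx uA w) -(mulKVmx uA s) Ac.
by rewrite qpol_opposite mulr0.
Qed.

Lemma semi_invariant_monmx A : A \in unitmx -> semi_invariant A ->
  exists2 c, c != 0 &
    exists d m, A = monmx d m /\ forall r, d r ^+ 3 * d (r + 1) = c.
Proof.
move=> uA [c c0 Ac]; exists c => //.
have Ae := @semi_invariant_column A c uA Ac.
pose a j := projT1 (Ae j); pose t j : 'I_4 := s2val (projT2 (Ae j)).
have AE j : A *m e j = a j *: e (t j) by apply: (s2valP' (projT2 (Ae j))).
have qZ x y i j : qpol (x *: e i) (x *: e i) (x *: e i) (y *: e j) =
    x ^+ 3 * y * (j == i + 1)%:R.
  rewrite -qpol_delta /qpol mulr_sumr; apply: eq_bigr => l _.
  by rewrite !mxE; ring.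
(* Equivariance at (e_j, e_j, e_j, e_(j+1)), where the polar form is 1; as c is nonzero, the indices
   [t j] must be consecutive. *)
have key j : a j ^+ 3 * a (j + 1) * (t (j + 1) == t j + 1)%:R = c.
  rewrite -qZ -!AE (@semi_invariant_qpol A c Ac) qpol_delta eqxx.
  exact: mulr1.
have tS j : t (j + 1) = t j + 1.
  apply/eqP; apply: contraNT c0 => /negPf tj.
  by rewrite -(key j) tj mulr0.
have tE j : t j = j + t 0.
  have t1 := tS 0; have t2 := tS 1; have t3 := tS 2.
  rewrite add0r in t1; rewrite (_ : 1 + 1 = 2) in t2; last by apply: val_inj.
  rewrite (_ : 2 + 1 = 3) in t3; last by apply: val_inj.
  elim/I4P: j; rewrite ?add0r // ?t3 ?t2 ?t1; elim/I4P: (t 0); exact: val_inj.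
(* Column s carries [a s] in row s + [t 0]; this reindexes by rows. *)
exists (fun r => a (r - t 0)), (- t 0); split=> [|r].
  apply/matrixP => r s; have /matrixP/(_ r 0) := AE s.
  rewrite -colE !mxE => ->; rewrite andbT tE -subr_eq eq_sym.
  by case: eqP => [->|_]; rewrite ?mulr1 ?mulr0.
by rewrite addrAC -[RHS](key (r - t 0)) tS eqxx mulr1.
Qed.

End Quartic.

(** * Semi-invariance under products and inverses, and its link with [Paut] *)

Section SemiInvariantGroup.
Variable k : fieldType.

Lemma semi_invariantM (A B : 'M[k]_4) :
  semi_invariant k A -> semi_invariant k B -> semi_invariant k (A *m B).
Proof.
case=> a a0 Aa [b b0 Bb]; exists (a * b); first exact: mulf_neq0.
by move=> v; rewrite -mulmxA Aa Bb mulrA.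
Qed.

Lemma semi_invariantV (A : 'M[k]_4) :
  A \in unitmx -> semi_invariant k A -> semi_invariant k (invmx A).
Proof.
move=> uA [a a0 Aa]; exists a^-1; first by rewrite invr_eq0.
by move=> v; apply: (mulfI a0); rewrite mulrA divff // mul1r -Aa mulKVmx.
Qed.

Lemma Paut_semi_invariant (g : PGL k 4) : Paut (klein_form k) g ->
  exists2 A : GL k 4, g = pclass A & semi_invariant k (glval A).
Proof.
case=> A [gA [c c0 Ac]]; exists A => //; exists c => // v.
by rewrite -form_subst_eval Ac mevalZ klein_form_eval.
Qed.

Lemma pclassX (A : GL k 4) n : pclass (A ^+ n)%g = (pclass A ^+ n)%g.
Proof. by elim: n => // n IHn; rewrite !expgS pclassM IHn. Qed.

End SemiInvariantGroup.

(** * The group generated by the classes of B and C *)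

Section Generators.
Variables (k : fieldType) (beta : k) (beta0 : beta != 0).
Hypothesis beta_order : 20.-primitive_root beta.

Let b (r : 'I_4) : k := [tuple 1; beta; beta ^- 2; beta ^+ 7]`_r.

Lemma glvalBC i j :
  glval (Bgl beta0 ^+ i * Cgl k ^+ j)%g = monmx k (fun r => b r ^+ i) j%:R.
Proof.
have BE : Bmx beta = monmx k b 0.
  by apply/matrixP => r s; rewrite !mxE addr0 (eq_sym s).
have CE : Cmx k = monmx k (fun=> 1) 1.
  apply/matrixP => r s; rewrite !mxE.
  by elim/I4P: r; elim/I4P: s.
have oneE : 1%:M = monmx k (fun=> 1) 0.
  by apply/matrixP => r s; rewrite !mxE addr0 (eq_sym s).
have BX : glval (Bgl beta0 ^+ i)%g = monmx k (fun r => b r ^+ i) 0.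
  elim: i => [|i IHi]; first by rewrite /= oneE.
  rewrite expgS /= IHi BE monmx_mul addr0.
  by apply/matrixP => r s; rewrite !mxE !addr0 exprS.
have CX : glval (Cgl k ^+ j)%g = monmx k (fun=> 1) j%:R.
  elim: j => [|j IHj]; first by rewrite /= oneE.
  rewrite expgS /= IHj CE monmx_mul -mulrS.
  by apply/matrixP => r s; rewrite !mxE mulr1.
rewrite /= BX CX monmx_mul add0r.
by apply/matrixP => r s; rewrite !mxE mulr1.
Qed.

(** The exponents 0, 1, -2, 7 satisfy 3 n_r + n_(r+1) = 1, up to the wrap-around 21, which is 1
    modulo 20. *)
Lemma b_relation r : b r ^+ 3 * b (r + 1) = beta.
Proof.
have b20 := prim_expr_order beta_order.
elim/I4P: r; rewrite /b /=.
- by rewrite expr1n mul1r.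
- by rewrite exprS mulfK ?expf_neq0.
- rewrite -exprVn -exprM exprVn; apply: (mulfI (expf_neq0 6 beta0)).
  by rewrite mulVKf ?expf_neq0 // -exprSr.
- by rewrite -exprM mulr1 exprSr b20 mul1r.
Qed.

Lemma G80_Paut g : g \in G80 beta0 -> Paut (klein_form k) g.
Proof.
case/imfset2P=> i _ [j _ ->]; exists (Bgl beta0 ^+ i * Cgl k ^+ j)%g.
rewrite pclassM !pclassX; split=> //; exists (beta ^+ i); first exact: expf_neq0.
rewrite glvalBC; apply: form_subst_monmx => r.
by rewrite -exprM mulnC exprM -exprMn b_relation.
Qed.

Lemma mem_G80 (A : GL k 4) :
  6 != 0 :> k -> semi_invariant k (glval A) -> pclass A \in G80 beta0.
Proof.
move=> six0 /(semi_invariant_monmx k six0 _ (glvalP A)).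
case=> c c0 [d [m [Am dc]]].
have d0 r : d r != 0.
  by apply: contraNneq c0 => dr; rewrite -(dc r) dr expr0n mul0r.
have dS r : d (r + 1) = c / d r ^+ 3.
  by rewrite -(dc r) mulrC mulKf ?expf_neq0.
(* With u = c / d_0^4, the recursion gives d_r / d_0 = u^(n_r) where n_(r+1) = 1 - 3 n_r: exponents
   0, 1, -2, 7, and then -20 on returning to index 0, so u^20 = 1. *)
have d1 : d 1 = d 0 * (c / d 0 ^+ 4).
  by have := dS 0; rewrite add0r => ->; field; exact: d0.
have d2 : d 2 = d 0 * (c / d 0 ^+ 4) ^- 2.
  rewrite (_ : 2 = 1 + 1); last by apply: val_inj.
  by rewrite dS d1; field; rewrite c0 d0.
have d3 : d 3 = d 0 * (c / d 0 ^+ 4) ^+ 7.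
  rewrite (_ : 3 = 2 + 1); last by apply: val_inj.
  by rewrite dS d2; field; rewrite c0 d0.
have u20 : (c / d 0 ^+ 4) ^+ 20 = 1.
  have := dS 3; rewrite (_ : 3 + 1 = 0); last by apply: val_inj.
  move=> d4; apply: invr_inj; apply: (mulfI (d0 0)).
  by rewrite invr1 mulr1 [RHS]d4 d3; field; rewrite c0 d0.
have [i ui] := prim_rootP beta_order u20.
apply/imfset2P; exists (val i); first by rewrite mem_iota /=.
exists (val m); first by rewrite mem_iota /=.
rewrite -!pclassX -[RHS]pclassM; apply/eqP; rewrite eq_pclass pgl_rel_sym.
apply/pgl_relP; exists (d 0).
  by rewrite unitmxE det_scalar unitfE expf_neq0.
rewrite glvalBC Am; apply/matrixP => r s; rewrite !mxE natr_Zp mulrnAr.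
congr (_ *+ _); elim/I4P: r; rewrite /b /= ?expr1n ?mulr1 //.
- by rewrite d1 ui.
- by rewrite d2 ui -!exprVn -!exprM mulnC.
- by rewrite d3 ui -!exprM mulnC.
Qed.

(** The class of B^i C^j determines (i, j): the position of the nonzero entry in row 0 gives j, its
    value 1 fixes the scalar, and the entry beta^i in row 1 gives i. *)
Lemma card_G80 : #|` G80 beta0| = 80%N.
Proof.
have b0 : b 0 = 1 by [].
have inj i j i' j' : (i < 20)%N -> (j < 4)%N -> (i' < 20)%N -> (j' < 4)%N ->
    (pclass (Bgl beta0) ^+ i * pclass (Cgl k) ^+ j =
     pclass (Bgl beta0) ^+ i' * pclass (Cgl k) ^+ j')%g -> i = i' /\ j = j'.
  move=> lti ltj lti' ltj'; rewrite -!pclassX -[LHS]pclassM -[RHS]pclassM.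
  move/eqP; rewrite eq_pclass => /pgl_relP[c _]; rewrite !glvalBC => BC.
  have jj : j = j'.
    have /matrixP/(_ 0 j'%:R) := BC; rewrite !mxE !add0r eqxx b0 !expr1n.
    case: eqP => [jj _|_ /eqP]; last by rewrite mulr0 oner_eq0.
    have := congr1 val jj.
    by rewrite !Zp_nat /= !modn_small.
  rewrite jj in BC *; split=> //.
  have c1 : c = 1.
    have /matrixP/(_ 0 j'%:R) := BC; rewrite !mxE !add0r eqxx b0 !expr1n.
    by rewrite mulr1.
  have /matrixP/(_ 1 (1 + j'%:R)) := BC; rewrite c1 scale1r !mxE eqxx.
  move/eqP; rewrite /b /= !mulr1n (eq_prim_root_expr beta_order).
  by rewrite !modn_small // => /eqP.
have sizeI n (p : finmempred nat) : p =i iota 0 n -> size (enum_finmem p) = n.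
  move=> pE; rewrite -[RHS](size_iota 0 n); apply: perm_size; apply: uniq_perm.
  - exact: enum_finmem_uniq.
  - exact: iota_uniq.
  - by move=> x; rewrite enum_finmemE pE.
rewrite /G80 (perm_size (enum_imfset2 _ _)).
  rewrite size_allpairs (sizeI 20%N) ?(sizeI 4%N) //.
have ltI n x : x \in iota 0 n -> (x < n)%N by rewrite mem_iota.
move=> [i j] [i1 j1] /andP[/ltI iI /ltI jI] /andP[/ltI i1I /ltI j1I] /inj[] //.
by move=> /= -> ->.
Qed.

End Generators.

Theorem theorem6p1 (k : closedFieldType) (char0 : [pchar k] =i pred0)
    (beta : k) (beta0 : beta != 0) (beta_order : 20.-primitive_root beta) :
  [/\ group_closed (mem (G80 beta0)),
      #|` G80 beta0| = 80%N
    & forall g : PGL k 4, Paut (klein_form k) g <-> g \in G80 beta0].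
Proof.
have six0 : 6 != 0 :> k by rewrite ((pcharf0P k).1 char0).
have PautP (g : PGL k 4) : Paut (klein_form k) g <-> g \in G80 beta0.
  split=> [/Paut_semi_invariant[A -> ?]|]; first exact: mem_G80.
  exact: G80_Paut.
split=> //; last exact: card_G80.
(* Closure is obtained through [Paut]: representatives are semi-invariant, a property stable under A
   B^-1, and [mem_G80] leads back. *)
have G80_repr g : g \in G80 beta0 ->
    exists2 A : GL k 4, g = pclass A & semi_invariant k (glval A).
  by move/PautP/Paut_semi_invariant.
split.
  apply: (mem_G80 _ _ beta0 beta_order 1%g six0); exists 1; rewrite ?oner_eq0 //.
  by move=> v; rewrite mul1mx mul1r.
move=> g h /G80_repr[A -> sA] /G80_repr[B -> sB].
have -> : (pclass A / pclass B)%g = pclass (A * B^-1)%g.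
  by rewrite pclassM pclassV.
apply: mem_G80 => //; apply: semi_invariantM => //.
by apply: semi_invariantV sB; apply: glvalP.
Qed.
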